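(* Let $t=\{t_k\}_{k=1}^\infty$ and $s=\{s_k\}_{k=1}^\infty$ be non-increasing sequences of positive numbers. Let $n\in\mathbb{N}$, $1<p<\infty$, $q=p/(p-1)$, $1<r<\infty$ and $\varepsilon\ge0$. Let $d_1,\ldots,d_n$ be the numbers defined in the context. 1. If $\varepsilon\le d_n$, then $$\mathcal{E}\left(A,W^{T,S}_{p,q},J^n_{\varepsilon,r}\right)=\mathcal{E}\left(A,W^{T,S}_{p,q},J^n_{\varepsilon,r},\Psi^*_n\right)=t_{n+1}s_{n+1}+\varepsilon\left(\sum_{j=1}^n\left(1-\frac{t_{n+1}s_{n+1}}{t_js_j}\right)^{\frac{r}{r-1}}\right)^{\frac{r-1}{r}}.$$ 2. If $\varepsilon\in(d_n,d_1]$, then there exist $m\in\{1,\ldots,n-1\}$ such that $\varepsilon\in(d_{m+1},d_m]$ and $\lambda=\lambda(\varepsilon)\in[0,1)$ such that $$\varepsilon=\left(\sum_{j=1}^m\left(1-\frac{t_{m,\lambda}s_{m,\lambda}}{t_js_j}\right)^{\frac{r}{r-1}}\right)^{1/r}\left(\sum_{j=1}^m\frac{1}{t_js_j}\left(1-\frac{t_{m,\lambda}s_{m,\lambda}}{t_js_j}\right)^{\frac{1}{r-1}}\right)^{-1}.$$ Then $$\mathcal{E}\left(A,W^{T,S}_{p,q},J^n_{\varepsilon,r}\right)=\mathcal{E}\left(A,W^{T,S}_{p,q},J^n_{\varepsilon,r},\Psi^*_{m,\lambda}\right)=t_{m,\lambda}s_{m,\lambda}+\varepsilon\left(\sum_{j=1}^m\left(1-\frac{t_{m,\lambda}s_{m,\lambda}}{t_js_j}\right)^{\frac{r}{r-1}}\right)^{\frac{r-1}{r}}.$$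 3. If $\varepsilon>d_1$, then $\mathcal{E}\left(A,W^{T,S}_{p,q},J^n_{\varepsilon,r}\right)=\mathcal{E}\left(A,W^{T,S}_{p,q},J^n_{\varepsilon,r},\Psi^*_0\right)=t_1s_1$.
   Context: $\ell_p$, $\ell_q$ are the usual spaces of complex sequences with norms $\|\cdot\|_p,\|\cdot\|_q$. Put $Th=\{t_kh_k\}_{k=1}^\infty$ for $h\in\ell_p$ and $Sg=\{s_kg_k\}_{k=1}^\infty$ for $g\in\ell_q$. The classes are $W^T_p=\{Th:h\in\ell_p,\|h\|_p\le1\}$, $W^S_q=\{Sg:g\in\ell_q,\|g\|_q\le1\}$ and $W^{T,S}_{p,q}=W^T_p\times W^S_q$. The operator is $A:\ell_p\times\ell_q\to\mathbb{C}$, $A(x,y)=\langle x,y\rangle=\sum_{k=1}^\infty x_ky_k$. An information mapping $J$ assigns to each $(x,y)\in\ell_p\times\ell_q$ a non-empty subset $J(x,y)\subset\mathbb{C}^n\times\mathbb{C}^n$. A method of recovery is an arbitrary mapping $\Psi:\mathbb{C}^n\times\mathbb{C}^n\to\mathbb{C}$. Its error is $\mathcal{E}(A,W,J,\Psi)=\sup_{(x,y)\in W}\sup_{(a,b)\in J(x,y)}|\langle x,y\rangle-\Psi(a,b)|$, and $\mathcal{E}(A,W,J)=\inf_\Psi\mathcal{E}(A,W,J,\Psi)$ over all methods $\Psi$. Here $J^n_{\varepsilon,r}(x,y)=\{(a,b)\in\mathbb{C}^n\times\mathbb{C}^n:(\sum_{k=1}^n|x_ky_k-a_kb_k|^r)^{1/r}\le\varepsilon\}$.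 Numbers $d_m$: put $\tau_{j,m}=\left(1-\frac{t_{m+1}s_{m+1}}{t_js_j}\right)^{\frac{1}{r-1}}$ for $1\le j\le m\le n$; set $d_1:=t_1s_1$ and, for $2\le m\le n$, $$d_m:=\left(\sum_{j=1}^m\tau_{j,m}^r\right)^{1/r}\left(\sum_{j=1}^m\frac{\tau_{j,m}}{t_js_j}\right)^{-1}.$$ For $\lambda\in[0,1]$: $t_{m,\lambda}:=(1-\lambda)t_{m+1}+\lambda t_m$ and $s_{m,\lambda}:=(1-\lambda)s_{m+1}+\lambda s_m$. Methods, for $a,b\in\mathbb{C}^n$: $$\Psi^*_n(a,b)=\sum_{k=1}^na_kb_k\left(1-\frac{t_{n+1}s_{n+1}}{t_ks_k}\right),\qquad \Psi^*_{m,\lambda}(a,b)=\sum_{j=1}^ma_jb_j\left(1-\frac{t_{m,\lambda}s_{m,\lambda}}{t_js_j}\right),\qquad\Psi^*_0(a,b)=0.$$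
   Formalization: In part 2 the printed λ-equation has in general no solution for d_{m+1}<ε<d_m; there the sums, t_{m,λ}, s_{m,λ} and Ψ* may be taken at index m+1 (index m if ε=d_m). Where t_{k+1}s_{k+1}=t_1s_1 the equation is 0/0 and is not required; undefined d_m are set to 0. *)

(* Defs.v *)
From HB Require Import structures.
From mathcomp Require Import all_boot all_order all_algebra.
From mathcomp Require Import complex.
From mathcomp Require Import all_classical all_reals all_analysis.

Set Implicit Arguments.
Unset Strict Implicit.
Unset Printing Implicit Defensive.

Import Order.TTheory GRing.Theory Num.Theory numFieldNormedType.Exports.
Local Open Scope classical_set_scope.
Local Open Scope ring_scope.

(* All sequences and finite coordinate vectors are indexed from 0: [t k] stands for t_{k+1}, so that
   t_{m+1} is [t m] and a sum over 1 <= j <= m is a sum over [j < m]. The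
   numbers m, n, k counting terms (d_m, Psi_{m,lambda}, ...) are not shifted. *)

Section Recovery.
Context {R : realType}.

(* The modulus as a real number; [`|z|] on R[i] is itself R[i]-valued. *)
Definition cmod (z : R[i]) : R := ComplexField.Normc.normc z.

Definition lp_norm (p : R) (x : nat -> R[i]) : \bar R :=
  ((\sum_(0 <= k <oo) (cmod (x k) `^ p)%:E) `^ p^-1)%E.

Definition lp_space (p : R) : set (nat -> R[i]) :=
  [set x | (lp_norm p x < +oo)%E].

Definition diag_op (t : nat -> R) (h : nat -> R[i]) : nat -> R[i] :=
  fun k => (t k)%:C%C * h k.

Definition diag_class (t : nat -> R) (p : R) : set (nat -> R[i]) :=
  [set x | exists h, [/\ lp_space p h, (lp_norm p h <= 1)%E & x = diag_op t h]].

(* W^{T,S}_{p,q} *)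
Definition class_pair (t s : nat -> R) (p q : R) :
    set ((nat -> R[i]) * (nat -> R[i])) :=
  diag_class t p `*` diag_class s q.

(* The limit is taken in R[i]^o, i.e. for the topology given by the modulus. *)
Definition inner (xy : (nat -> R[i]) * (nat -> R[i])) : R[i] :=
  limn (series (fun k => xy.1 k * xy.2 k) : nat -> R[i]^o).

Definition recovery_error (X Y : Type) (A : X -> R[i]) (W : set X)
    (J : X -> set Y) (Psi : Y -> R[i]) : \bar R :=
  ereal_sup [set ereal_sup [set (cmod (A x - Psi y))%:E | y in J x] | x in W].

Definition optimal_error (X Y : Type) (A : X -> R[i]) (W : set X)
    (J : X -> set Y) : \bar R :=
  ereal_inf [set recovery_error A W J Psi | Psi in [set: Y -> R[i]]].

(* J^n_{eps,r} *)
Definition info (n : nat) (eps r : R) (xy : (nat -> R[i]) * (nat -> R[i])) :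
    set ('rV[R[i]]_n * 'rV[R[i]]_n) :=
  [set ab : 'rV[R[i]]_n * 'rV[R[i]]_n | (\sum_(k < n)
      cmod (xy.1 k * xy.2 k - ab.1 ord0 k * ab.2 ord0 k) `^ r) `^ r^-1 <= eps].

Definition tau (t s : nat -> R) (r : R) (j m : nat) : R :=
  (1 - t m * s m / (t j * s j)) `^ (r - 1)^-1.

(* d_m for m >= 1. If m >= 2 and t_{m+1}s_{m+1} = t_1 s_1 the formula reads 0/0,
   which is 0 here. *)
Definition dnum (t s : nat -> R) (r : R) (m : nat) : R :=
  if m == 1%N then t 0%N * s 0%N else
  (\sum_(j < m) tau t s r j m `^ r) `^ r^-1
    * (\sum_(j < m) tau t s r j m / (t j * s j))^-1.

(* t_{m,lambda} = (1 - lambda) t_{m+1} + lambda t_m, for m >= 1 *)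
Definition mix (t : nat -> R) (m : nat) (lam : R) : R :=
  (1 - lam) * t m + lam * t m.-1.

(* Psi^*_n is the case m = n, c = t_{n+1}s_{n+1}; Psi^*_{m,lambda} is the case
   c = t_{m,lambda}s_{m,lambda}. *)
Definition trunc_method (t s : nat -> R) (n m : nat) (c : R)
    (ab : 'rV[R[i]]_n * 'rV[R[i]]_n) : R[i] :=
  \sum_(j < n | (j < m)%N)
    ab.1 ord0 j * ab.2 ord0 j * (1 - c / (t j * s j))%:C%C.

Definition zero_method (n : nat) (ab : 'rV[R[i]]_n * 'rV[R[i]]_n) : R[i] := 0.

(* The right-hand side of the equation determining lambda, with
   c = t_{m,lambda}s_{m,lambda}. *)
Definition eps_of (t s : nat -> R) (r : R) (m : nat) (c : R) : R :=
  (\sum_(j < m) (1 - c / (t j * s j)) `^ (r / (r - 1))) `^ r^-1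
    * (\sum_(j < m) (t j * s j)^-1 * (1 - c / (t j * s j)) `^ (r - 1)^-1)^-1.

Definition error_value (t s : nat -> R) (r eps : R) (m : nat) (c : R) : R :=
  c + eps * (\sum_(j < m) (1 - c / (t j * s j)) `^ (r / (r - 1)))
              `^ ((r - 1) / r).

End Recovery.

(* Main.v *)
Require Import Defs.
From HB Require Import structures.
From mathcomp Require Import all_boot all_order all_algebra.
From mathcomp Require Import complex.
From mathcomp Require Import all_classical all_reals all_analysis.
From mathcomp Require Import ring.

Import Order.TTheory GRing.Theory Num.Theory numFieldNormedType.Exports.
Local Open Scope ring_scope.

Set Implicit Arguments.
Unset Strict Implicit.
Unset Printing Implicit Defensive.

(** Write u_k = t_k s_k. For x = T h and y = S g the products are
    x_k y_k = u_k w_k with w_k = h_k g_k, and by Hoelder's inequality w runs over the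
    unit ball of l_1. The problem is thus the recovery of the linear functional
    sum_k u_k w_k on that ball from noisy values of its first n terms.

    For the upper bound, the method with threshold c keeps the fraction 1 - c / u_j
    of each measured term of weight above c. What it discards is a combination of
    the w_k with coefficients at most c, hence costs at most c; the noise costs at
    most eps times the conjugate norm of the coefficients, by Hoelder's inequality
    again. This works for every c between u_m and u_(m-1)
    (lemma trunc_method_error_le).

    For the lower bound, an element w of the ball whose measured part has l_r norm
    at most eps is indistinguishable from its opposite, both being compatible with the
    data 0, so no method does better than sum_k u_k w_k (lemma optimal_error_ge).
    The two bounds meet when w is extremal in Hoelder's inequality, has measured
    norm eps and total mass 1 (lemma error_value_le_optimal). For eps <= d_n the
    extremal vector has mass at most 1, and the rest can be put on the first
    unmeasured coordinate, of weight c = u_n. For larger eps the threshold c is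
    raised until the mass is exactly 1: this is the equation for lambda, solved
    by the intermediate value theorem because its right-hand side joins d_m to d_(m-1)
    continuously (lemma eps_of_surjective). For eps > d_1 all the mass sits on the
    first coordinate, and nothing beats the method 0.

    The d_m need not be monotone when several leading weights are equal, since then
    d_m = 0 for all m >= 2 with u_m = u_0. Choosing the last m with eps <= d_m
    (lemma last_interval) leaves one degenerate case, u_1 = u_0 with eps above all
    later d_m, where an even spread of the mass over the run replaces the
    extremal vector (lemma trunc_method_optimal_flat). *)

(** * Hoelder's inequality for finite sums *)

Lemma conjugate_exponent (R : realType) (r : R) (r_gt1 : 1 < r) :
  0 < r / (r - 1) /\ r^-1 + (r / (r - 1))^-1 = 1.
Proof.
split; first by rewrite divr_gt0 ?subr_gt0 // (lt_trans ltr01).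
have r0 : r != 0 by rewrite gt_eqF // (lt_trans ltr01).
have r1 : r - 1 != 0 by rewrite gt_eqF ?subr_gt0.
by field; rewrite r0 r1.
Qed.

Lemma powR_root_le (R : realType) (x e r : R) (x_ge0 : 0 <= x) (e_ge0 : 0 <= e)
    (r_gt0 : 0 < r) : (x `^ r^-1 <= e) = (x <= e `^ r).
Proof.
have rV : 0 < r^-1 by rewrite invr_gt0.
apply/idP/idP => h.
- have := @ge0_ler_powR _ r (ltW r_gt0) _ _ _ _ h.
  rewrite -powRrM mulVf ?gt_eqF // powRr1 //; apply.
  + by rewrite nnegrE powR_ge0.
  + by rewrite nnegrE.
- have := @ge0_ler_powR _ r^-1 (ltW rV) _ _ _ _ h.
  rewrite -powRrM mulfV ?gt_eqF // powRr1 //; apply.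
  + by rewrite nnegrE.
  + by rewrite nnegrE powR_ge0.
Qed.

(** The l_r norm of a enters through an upper bound e, which may exceed it; zero
    factors are split off because the proof normalises by e and by the norm of
    b. *)
Lemma finite_hoelder (R : realType) (n : nat) (r e : R) (a b : 'I_n -> R)
    (r_gt1 : 1 < r) (e_ge0 : 0 <= e) (a_ge0 : forall i, 0 <= a i)
    (b_ge0 : forall i, 0 <= b i)
    (a_norm : (\sum_i a i `^ r) `^ r^-1 <= e) :
  \sum_i a i * b i <= e * (\sum_i b i `^ (r / (r - 1))) `^ ((r - 1) / r).
Proof.
have r_gt0 : 0 < r by rewrite (lt_trans ltr01).
have [r'_gt0 conj] := conjugate_exponent r_gt1.
set r' := r / (r - 1) in r'_gt0 conj *.
have -> : (r - 1) / r = r'^-1 by rewrite /r' invf_div.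
have Sa_ge0 : 0 <= \sum_i a i `^ r by apply: sumr_ge0 => i _; apply: powR_ge0.
have Sb_ge0 : 0 <= \sum_i b i `^ r' by apply: sumr_ge0 => i _; apply: powR_ge0.
rewrite powR_root_le // in a_norm.
have [e0|e_neq0] := eqVneq e 0.
  rewrite e0 mul0r big1 // => i _.
  have Sa0 : \sum_i a i `^ r = 0.
    by apply/eqP; rewrite eq_le Sa_ge0 andbT (le_trans a_norm) // e0 powR0 ?gt_eqF.
  by rewrite (powR_eq0_eq0 (psumr_eq0P (fun j _ => powR_ge0 (a j) r) Sa0 isT)) mul0r.
have [Sb0|Sb_neq0] := eqVneq (\sum_i b i `^ r') 0.
  rewrite Sb0 powR0 ?invr_eq0 ?gt_eqF // mulr0 big1 // => i _.
  by rewrite (powR_eq0_eq0 (psumr_eq0P (fun j _ => powR_ge0 (b j) r') Sb0 isT)) mulr0.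
have e_gt0 : 0 < e by rewrite lt_def e_neq0.
have Sb_gt0 : 0 < \sum_i b i `^ r' by rewrite lt_def Sb_neq0.
set C := (\sum_i b i `^ r') `^ r'^-1.
have C_gt0 : 0 < C by apply: powR_gt0.
have Cr : C `^ r' = \sum_i b i `^ r'.
  by rewrite /C -powRrM mulVf ?gt_eqF // powRr1.
have scale x y z : 0 <= x -> 0 < y -> (x / y) `^ z = x `^ z / y `^ z.
  move=> x0 y0; rewrite powRM ?invr_ge0 ?(ltW y0) //.
  by rewrite -[y^-1]powR_inv1 ?(ltW y0) // -powRrM mulN1r powRN.
(* Young's inequality is applied to both factors normalised to norm one *)
suff: \sum_i (a i / e) * (b i / C) <= 1.
  have -> : \sum_i (a i / e) * (b i / C) = (\sum_i a i * b i) / (e * C).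
    rewrite mulr_suml; apply: eq_bigr => i _; field.
    by rewrite e_neq0 gt_eqF.
  by rewrite ler_pdivrMr ?mul1r // mulr_gt0.
apply: (@le_trans _ _ (\sum_i ((a i `^ r / e `^ r) / r + (b i `^ r' / C `^ r') / r'))).
  apply: ler_sum => i _.
  have := @conjugate_powR R (a i / e) (b i / C) r r'.
  rewrite !scale //; apply=> //.
  - by rewrite divr_ge0.
  - by rewrite divr_ge0 // ltW.
rewrite big_split /= -!mulr_suml Cr mulfV // mul1r -conj lerD2r.
rewrite ler_pdivrMr // mulVf ?gt_eqF // ler_pdivrMr ?mul1r // powR_gt0 //.
Qed.

(** * The modulus and convergence of complex series *)

Section Modulus.
Context {R : realType}.
Implicit Types z : R[i].

Lemma cmod_ge0 z : 0 <= cmod z.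
Proof. by case: z => a b; rewrite /cmod /= sqrtr_ge0. Qed.

Lemma cmodM z w : cmod (z * w) = cmod z * cmod w.
Proof. exact: ComplexField.Normc.normcM. Qed.

Lemma cmodN z : cmod (- z) = cmod z.
Proof. exact: normcN. Qed.

Lemma cmodD z w : cmod (z + w) <= cmod z + cmod w.
Proof. exact: le_normcD. Qed.

Lemma cmod0 : cmod (0 : R[i]) = 0.
Proof. exact: ComplexField.Normc.normc0. Qed.

Lemma cmodR (x : R) : cmod x%:C%C = `|x|.
Proof. by rewrite /cmod /= expr0n /= addr0 sqrtr_sqr. Qed.

Lemma normr_cmod z : `|z| = (cmod z)%:C%C.
Proof. by rewrite normc_def; case: z. Qed.

Lemma cmod_sum (I : Type) (s : seq I) (P : pred I) (F : I -> R[i]) :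
  cmod (\sum_(i <- s | P i) F i) <= \sum_(i <- s | P i) cmod (F i).
Proof.
elim/big_rec2: _ => [|i y x _ h]; first by rewrite cmod0.
by apply: (le_trans (cmodD _ _)); rewrite lerD2l.
Qed.

Lemma Re_le_cmod z : `|complex.Re z| <= cmod z.
Proof.
case: z => a b; rewrite /cmod /= -sqrtr_sqr ler_wsqrtr // lerDl sqr_ge0 //.
Qed.

Lemma Im_le_cmod z : `|complex.Im z| <= cmod z.
Proof.
case: z => a b; rewrite /cmod /= -sqrtr_sqr ler_wsqrtr // lerDr sqr_ge0 //.
Qed.

Lemma cmod_le_ReIm z : cmod z <= `|complex.Re z| + `|complex.Im z|.
Proof.
case: z => a b; rewrite [complex.Re _]/= [complex.Im _]/=.
rewrite [X in cmod X](_ : _ = a%:C%C + (0 +i* b)%C); last by simpc.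
apply: (le_trans (cmodD _ _)); rewrite cmodR lerD2l /cmod /= expr0n /= add0r.
by rewrite sqrtr_sqr.
Qed.

End Modulus.

Lemma sum_abs_cvg (R : realType) (x : nat -> R) (M : R)
    (x_sum : forall N, \sum_(k < N) `|x k| <= M) : cvgn (series x).
Proof.
apply: normed_cvg; apply: nondecreasing_is_cvgn.
  apply/nondecreasing_seqP => N; rewrite /normed_series_of /series.
  by rewrite [leRHS]big_nat_recr //= lerDl.
by exists M => _ [N _ <-]; rewrite /normed_series_of /series /= big_mkord.
Qed.

(** Absolute convergence gives the limit of the real and of the imaginary part,
    hence a limit in the topology of the modulus; closed discs contain the
    limits of their sequences. *)
Lemma inner_in_disc (R : realType) (xy : (nat -> R[i]) * (nat -> R[i]))
    (z : R[i]) (M V : R) (n : nat)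
    (abs_sum : forall N, \sum_(k < N) cmod (xy.1 k * xy.2 k) <= M)
    (near_z : forall N, (n <= N)%N ->
        cmod (\sum_(k < N) xy.1 k * xy.2 k - z) <= V) :
  cmod (inner xy - z) <= V.
Proof.
set v := fun k => xy.1 k * xy.2 k.
have reC : cvgn (series (fun k => complex.Re (v k))).
  apply: (@sum_abs_cvg _ _ M) => N; apply: (le_trans _ (abs_sum N)).
  by apply: ler_sum => k _; apply: Re_le_cmod.
have imC : cvgn (series (fun k => complex.Im (v k))).
  apply: (@sum_abs_cvg _ _ M) => N; apply: (le_trans _ (abs_sum N)).
  by apply: ler_sum => k _; apply: Im_le_cmod.
set a := limn (series (fun k => complex.Re (v k))) in reC.
set b := limn (series (fun k => complex.Im (v k))) in imC.
pose L : R[i] := (a +i* b)%C.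
have serE N : series v N = (series (fun k => complex.Re (v k)) N +i*
    series (fun k => complex.Im (v k)) N)%C.
  elim: N => [|N]; first by rewrite /series /= !big_geq.
  rewrite /series /= ![\sum_(0 <= k < N.+1) _]big_nat_recr //= => ->.
  by case: (v N) => x y; simpc.
have closeL e : 0 < e -> (\forall N \near \oo, cmod (L - series v N) < e)%classic.
  move=> e0; have e20 : 0 < e / 2 by rewrite divr_gt0.
  move/cvgrPdist_lt: reC => /(_ _ e20) reC.
  move/cvgrPdist_lt: imC => /(_ _ e20) imC.
  near=> N; rewrite serE; apply: (le_lt_trans (cmod_le_ReIm _)).
  rewrite [ltRHS]splitr; apply: ltrD => /=.
  - by near: N.
  - by near: N.
have -> : inner xy = L.
  have haus : hausdorff_space (R[i]^o) by exact: norm_hausdorff.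
  rewrite /inner; apply: (cvg_lim haus).
  apply/cvgrPdist_lt => e e0.
  (* a positive element of the field of complex numbers is real *)
  have [e' ee'] : exists e', e = e'%:C%C.
    by apply/complex_realP; rewrite gtr0_real.
  rewrite ee' ltcR in e0.
  have := closeL _ e0; apply: filterS => N; rewrite ee' -ltcR.
  by rewrite -normr_cmod.
apply/ler_addgt0Pr => e e0.
have [N0 _ hN] := closeL _ e0.
have -> : L - z = (\sum_(k < maxn n N0) v k - z) + (L - \sum_(k < maxn n N0) v k).
  by ring.
apply: (le_trans (cmodD _ _)); apply: lerD.
- by apply: near_z; rewrite leq_maxl.
- have /hN : (N0 <= maxn n N0)%N by rewrite leq_maxr.
  by rewrite /= /series /= big_mkord => /ltW.
Unshelve. all: by end_near.
Qed.

(** * The class as a weighted ball of l_1 *)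

Lemma sum_powR_le1 (R : realType) (p : R) (h : nat -> R[i]) (p_gt0 : 0 < p) :
  (lp_norm p h <= 1)%E -> forall N, \sum_(k < N) cmod (h k) `^ p <= 1.
Proof.
move=> h1 N; rewrite -lee_fin -sumEFin -(big_mkord xpredT (fun k => (cmod (h k) `^ p)%:E)).
have term0 k : (0 <= (cmod (h k) `^ p)%:E)%E by rewrite lee_fin powR_ge0.
apply: (le_trans (nneseries_lim_ge N _)) => //.
set S := (\sum_(0 <= k <oo) _)%E.
have S0 : (0 <= S)%E by apply: nneseries_ge0.
have -> : S = (lp_norm p h `^ p)%E.
  by rewrite /lp_norm -poweRrM mulVf ?gt_eqF // poweRe1.
rewrite -(poweR1r p); apply: gt0_ler_poweR => //; first exact: ltW.
- by rewrite in_itv /= leey andbT poweR_ge0.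
- by rewrite in_itv /= leey andbT lee01.
Qed.

Lemma lp_norm_finite_le1 (R : realType) (p : R) (h : nat -> R[i]) (N : nat)
    (p_gt0 : 0 < p) (h_supp : forall k, (N <= k)%N -> h k = 0) :
  \sum_(k < N) cmod (h k) `^ p <= 1 -> (lp_norm p h <= 1)%E.
Proof.
move=> h1; rewrite /lp_norm.
have term0 k : (0 <= (cmod (h k) `^ p)%:E)%E by rewrite lee_fin powR_ge0.
rewrite (nneseries_split 0 N) // add0n eseries0 ?adde0; last first.
  by move=> k Nk _; rewrite h_supp // cmod0 powR0 ?gt_eqF.
rewrite big_mkord sumEFin -[leRHS](poweR1r p^-1).
apply: gt0_ler_poweR; first by rewrite invr_ge0 ltW.
- by rewrite in_itv /= leey andbT lee_fin sumr_ge0 // => k _; rewrite powR_ge0.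
- by rewrite in_itv /= leey andbT lee01.
- by rewrite lee_fin.
Qed.

(** By Hoelder's inequality the products of the coordinates of the two factors
    range over a weighted unit ball of l_1; this is all that the problem
    retains of p and q. *)
Lemma class_pair_products (R : realType) (t s : nat -> R) (p q : R)
    (xy : (nat -> R[i]) * (nat -> R[i]))
    (p_gt1 : 1 < p) (q_def : q = p / (p - 1)) (xyW : class_pair t s p q xy) :
  exists2 w : nat -> R[i],
    forall k, xy.1 k * xy.2 k = (t k * s k)%:C%C * w k &
    forall N, \sum_(k < N) cmod (w k) <= 1.
Proof.
case: xy xyW => x y [/= [h [_ h1 ->]] [g [_ g1 ->]]].
exists (fun k => h k * g k) => [k|N].
  by rewrite /diag_op rmorphM /= mulrACA.
have p_gt0 : 0 < p by rewrite (lt_trans ltr01).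
have [q_gt0 _] := conjugate_exponent p_gt1; rewrite -q_def in q_gt0.
have hN := sum_powR_le1 p_gt0 h1 N; have gN := sum_powR_le1 q_gt0 g1 N.
under eq_bigr do rewrite cmodM.
apply: (le_trans (@finite_hoelder R N p 1 _ _ p_gt1 ler01 _ _ _)).
- by move=> i; exact: cmod_ge0.
- by move=> i; exact: cmod_ge0.
- by rewrite powR_root_le ?powR1 ?ler01 // sumr_ge0 // => i _; exact: powR_ge0.
- rewrite mul1r -q_def -[(p - 1) / p]invf_div -q_def.
  by rewrite powR_root_le ?powR1 ?ler01 // sumr_ge0 // => i _; exact: powR_ge0.
Qed.

Lemma inner_finite (R : realType) (xy : (nat -> R[i]) * (nat -> R[i])) (N : nat)
    (supp : forall k, (N <= k)%N -> xy.1 k * xy.2 k = 0) :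
  inner xy = \sum_(k < N) xy.1 k * xy.2 k.
Proof.
have haus : hausdorff_space (R[i]^o) by exact: norm_hausdorff.
rewrite /inner; apply: (lim_near_cst haus).
exists N => // M /= NM; rewrite /series /= (@big_cat_nat _ _ _ N) //=.
rewrite [X in _ + X]big_nat_cond [X in _ + X]big1 ?addr0 ?big_mkord //.
by move=> k; rewrite andbT => /andP[Nk _]; exact: supp.
Qed.

(** * Lower and upper bounds of the error *)

(** Two pairs of the class with opposite inner products share the data (0, 0)
    as soon as their products are eps-small; no method can then be closer to
    both of them than half of their distance. Nonnegative weights w of total
    mass at most 1 are split as w^(1/p) times w^(1/q). *)
Lemma optimal_error_ge (R : realType) (t s : nat -> R) (n : nat)
    (p q r eps : R) (w : nat -> R) (N : nat)
    (p_gt1 : 1 < p) (q_def : q = p / (p - 1))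
    (ts_ge0 : forall k, 0 <= t k * s k)
    (w_ge0 : forall k, 0 <= w k) (w_supp : forall k, (N <= k)%N -> w k = 0)
    (w_sum : \sum_(k < N) w k <= 1)
    (w_info : (\sum_(k < n) (t k * s k * w k) `^ r) `^ r^-1 <= eps) :
  ((\sum_(k < N) t k * s k * w k)%:E <=
    optimal_error inner (class_pair t s p q) (@info R n eps r))%E.
Proof.
have p_gt0 : 0 < p by rewrite (lt_trans ltr01).
have [q_gt0 conj] := conjugate_exponent p_gt1; rewrite -q_def in q_gt0 conj.
set V := \sum_(k < N) _.
pose x (e : R) k : R[i] := (e * w k `^ p^-1)%:C%C.
pose y k : R[i] := (w k `^ q^-1)%:C%C.
pose X e := (diag_op t (x e), diag_op s y).
have zero_root a k : 0 < a -> (N <= k)%N -> w k `^ a^-1 = 0.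
  by move=> a0 Nk; rewrite w_supp // powR0 // invr_eq0 gt_eqF.
have rootK a k : 0 < a -> (w k `^ a^-1) `^ a = w k.
  by move=> a0; rewrite -powRrM mulVf ?gt_eqF // powRr1.
have small a g : 0 < a -> (forall k, (N <= k)%N -> g k = 0) ->
    (forall k, cmod (g k) = w k `^ a^-1) -> lp_space a g /\ (lp_norm a g <= 1)%E.
  move=> a0 g0 gE; suff le1 : (lp_norm a g <= 1)%E.
    by split=> //; rewrite /lp_space /= (le_lt_trans le1) // ltry.
  apply: (lp_norm_finite_le1 a0 g0).
  by under eq_bigr do rewrite gE rootK //.
have XW e : `|e| = 1 -> class_pair t s p q (X e).
  move=> e1; split.
    exists (x e); have [] := @small p (x e) p_gt0.
    - by move=> k Nk; rewrite /x zero_root // mulr0.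
    - by move=> k; rewrite /x cmodR normrM e1 mul1r ger0_norm // powR_ge0.
    by move=> ? ?; split.
  exists y; have [] := @small q y q_gt0.
  - by move=> k Nk; rewrite /y zero_root.
  - by move=> k; rewrite /y cmodR ger0_norm // powR_ge0.
  by move=> ? ?; split.
have Xprod e k : (X e).1 k * (X e).2 k = (e * (t k * s k * w k))%:C%C.
  rewrite /X /= /diag_op /x /y -!rmorphM /=; congr (_%:C%C).
  rewrite mulrACA -[e * _ * _]mulrA -powRD ?conj ?powRr1 //; first by ring.
  by rewrite oner_eq0.
have Xinner e : inner (X e) = (e * V)%:C%C.
  rewrite (@inner_finite _ _ N); last first.
    by move=> k Nk; rewrite Xprod w_supp // !mulr0.
  by under eq_bigr do rewrite Xprod; rewrite -rmorph_sum -mulr_sumr.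
have Xinfo e : `|e| = 1 -> @info R n eps r (X e) (0, 0).
  move=> e1; rewrite /info /=; apply: le_trans w_info.
  have {}Xprod (k : 'I_n) :
      cmod ((X e).1 k * (X e).2 k - (0 : 'rV_n) ord0 k * (0 : 'rV_n) ord0 k) =
      t k * s k * w k.
    rewrite !mxE.
    rewrite mulr0 subr0.
    rewrite Xprod.
    rewrite cmodR normrM e1 mul1r.
    by rewrite ger0_norm // mulr_ge0.
  by under eq_bigr do rewrite Xprod.
rewrite /optimal_error; apply: le_ereal_inf_tmp => _ [Psi _ <-].
rewrite leNgt; apply/negP => lt_err.
pose z := Psi (0, 0).
have close e : `|e| = 1 -> cmod ((e * V)%:C%C - z) < V.
  move=> e1; rewrite -lte_fin; apply: le_lt_trans lt_err.
  apply: le_ereal_sup_tmp; eexists; first by exists (X e); [exact: XW | reflexivity].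
  apply: ereal_sup_ubound; exists (0, 0); first exact: Xinfo.
  by rewrite Xinner.
have := ltrD (close 1 (normr1 _)) (close (-1) (normrN1 _)).
rewrite ltNge => /negP; apply.
rewrite -[cmod (_ - z) in X in _ <= _ + X]cmodN; apply: le_trans (cmodD _ _).
have -> : (1 * V)%:C%C - z + - ((-1 * V)%:C%C - z) = (V + V)%:C%C.
  by rewrite mul1r mulN1r rmorphN rmorphD /=; ring.
by rewrite cmodR ler_norm.
Qed.

(** Replacing the weight u_j of the measured product by u_j - c leaves a remainder
    bounded by c times the l_1 norm, while Hoelder's inequality pays
    the measurement error against the coefficients 1 - c / u_j. *)
Lemma trunc_method_error_le (R : realType) (t s : nat -> R) (n m : nat)
    (p q r eps c : R)
    (p_gt1 : 1 < p) (q_def : q = p / (p - 1)) (r_gt1 : 1 < r) (eps_ge0 : 0 <= eps)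
    (ts_gt0 : forall k, 0 < t k * s k)
    (m_le_n : (m <= n)%N) (c_ge0 : 0 <= c)
    (c_le : forall j, (j < m)%N -> c <= t j * s j)
    (c_ge : forall k, (m <= k)%N -> t k * s k <= c) :
  (recovery_error inner (class_pair t s p q) (@info R n eps r)
     (@trunc_method R t s n m c) <= (error_value t s r eps m c)%:E)%E.
Proof.
apply: ge_ereal_sup => _ [xy xyW <-].
apply: ge_ereal_sup => _ [ab abJ <-]; rewrite lee_fin.
have [w vE w1] := class_pair_products p_gt1 q_def xyW.
pose u k := t k * s k.
pose gam k : R := if (k < m)%N then 1 - c / u k else 0.
have c_div j : (j < m)%N -> c / u j <= 1.
  by move=> jm; rewrite ler_pdivrMr ?mul1r ?c_le // ts_gt0.
have gam_ge0 k : 0 <= gam k.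
  by rewrite /gam; case: ifP => // km; rewrite subr_ge0 c_div.
pose z k : R[i] := if insub k is Some i then ab.1 ord0 i * ab.2 ord0 i else 0.
have zE (i : 'I_n) : z i = ab.1 ord0 i * ab.2 ord0 i by rewrite /z valK.
have truncE : trunc_method t s m c ab = \sum_(k < n) z k * (gam k)%:C%C.
  rewrite /trunc_method big_mkcond; apply: eq_bigr => k _.
  by rewrite zE /gam; case: ifP => // _; rewrite mulr0.
have noise : \sum_(k < n) cmod (xy.1 k * xy.2 k - z k) * gam k <=
    eps * (\sum_(j < m) (1 - c / u j) `^ (r / (r - 1))) `^ ((r - 1) / r).
  apply: (le_trans (@finite_hoelder R n r eps _ _ r_gt1 eps_ge0 _ _ _)).
  - by move=> i; exact: cmod_ge0.
  - by move=> i; exact: gam_ge0.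
  - by under eq_bigr do rewrite zE; exact: abJ.
  rewrite (big_ord_widen n (fun j => (1 - c / u j) `^ (r / (r - 1)))) //.
  rewrite [X in _ * X `^ _ <= _](_ : _ =
    \sum_(i < n | (i < m)%N) (1 - c / u i) `^ (r / (r - 1))) //.
  rewrite [RHS]big_mkcond; apply: eq_bigr => i _; rewrite /gam; case: ifP => // _.
  by rewrite powR0 // gt_eqF // (proj1 (conjugate_exponent r_gt1)).
have [M0 M0P] : exists M, forall k, u k <= M.
  exists (c + \sum_(j < m) u j) => k; have [km|mk] := ltnP k m.
    rewrite (bigD1 (Ordinal km)) //= addrCA lerDl addr_ge0 // sumr_ge0 // => j _.
    exact/ltW/ts_gt0.
  by rewrite (le_trans (c_ge _ mk)) // lerDl sumr_ge0 // => j _; exact/ltW/ts_gt0.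
have M0_ge0 : 0 <= M0 by rewrite (le_trans _ (M0P 0%N)) // ltW // ts_gt0.
apply: (@inner_in_disc _ _ _ M0 _ n) => [N|N nN].
  apply: (@le_trans _ _ (\sum_(k < N) M0 * cmod (w k))).
    apply: ler_sum => k _; rewrite vE cmodM cmodR ger0_norm ?(ltW (ts_gt0 _)) //.
    by rewrite ler_wpM2r ?cmod_ge0 // M0P.
  by rewrite -mulr_sumr ler_piMr.
(* the first sum is discarded by the method, the second is the noise *)
have -> : \sum_(k < N) xy.1 k * xy.2 k - trunc_method t s m c ab =
    \sum_(k < N) (u k * (1 - gam k))%:C%C * w k +
    \sum_(k < n) (xy.1 k * xy.2 k - z k) * (gam k)%:C%C.
  have -> : \sum_(k < n) (xy.1 k * xy.2 k - z k) * (gam k)%:C%C =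
      \sum_(k < N) (xy.1 k * xy.2 k) * (gam k)%:C%C - trunc_method t s m c ab.
    rewrite truncE; under eq_bigr do rewrite mulrBl.
    rewrite sumrB; congr (_ - _).
    rewrite (big_ord_widen N (fun k => xy.1 k * xy.2 k * (gam k)%:C%C)) //.
    rewrite big_mkcond; apply: eq_bigr => k _; case: ifP => // /negbT.
    rewrite -leqNgt => nk; rewrite /gam ltnNge (leq_trans m_le_n nk) /=.
    by rewrite mulr0.
  rewrite addrA -big_split /=; congr (_ - _); apply: eq_bigr => k _.
  by rewrite vE /u !rmorphM rmorphB /= rmorph1; ring.
rewrite /error_value; apply: (le_trans (cmodD _ _)); apply: lerD; last first.
  apply: (le_trans (cmod_sum _ _ _)); apply: le_trans noise.
  by apply: ler_sum => k _; rewrite cmodM cmodR ger0_norm.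
apply: (le_trans (cmod_sum _ _ _)).
apply: (@le_trans _ _ (\sum_(k < N) c * cmod (w k))); last first.
  by rewrite -mulr_sumr ler_piMr.
apply: ler_sum => k _; rewrite cmodM cmodR ler_wpM2r ?cmod_ge0 //.
have u_gt0 : 0 < u k := ts_gt0 k.
rewrite /gam; case: ltnP => km.
  by rewrite opprB addrCA subrr addr0 mulrC divfK ?gt_eqF // ger0_norm.
by rewrite subr0 mulr1 ger0_norm; [exact: c_ge | exact: ltW].
Qed.

Lemma optimal_method (R : realType) (X Y : Type) (A : X -> R[i]) (W : set X)
    (J : X -> set Y) (Psi : Y -> R[i]) (V : \bar R) :
  (recovery_error A W J Psi <= V)%E -> (V <= optimal_error A W J)%E ->
  optimal_error A W J = recovery_error A W J Psi /\ recovery_error A W J Psi = V.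
Proof.
move=> err_le V_le.
have opt_le : (optimal_error A W J <= recovery_error A W J Psi)%E.
  by apply: ereal_inf_lbound; exists Psi.
have errE : recovery_error A W J Psi = V.
  by apply/eqP; rewrite eq_le err_le (le_trans V_le opt_le).
by split=> //; apply/eqP; rewrite eq_le opt_le errE V_le.
Qed.

(** Equality in Hoelder's inequality forces the measured products of the
    extremal pair to be proportional to (1 - c / u_j)^(1/(r-1)), with the factor
    kap that makes their l_r norm equal to eps. The l_1 mass left over is put
    on the first unmeasured coordinate, whose weight is then c. When all the
    coefficients vanish, kap = eps / 0 = 0 and all the mass goes there. *)
Lemma error_value_le_optimal (R : realType) (t s : nat -> R) (n m : nat)
    (p q r eps c : R)
    (p_gt1 : 1 < p) (q_def : q = p / (p - 1)) (r_gt1 : 1 < r) (eps_ge0 : 0 <= eps)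
    (ts_gt0 : forall k, 0 < t k * s k)
    (m_le_n : (m <= n)%N)
    (c_le : forall j, (j < m)%N -> c <= t j * s j)
    (mass_le1 : eps / (\sum_(j < m) (1 - c / (t j * s j)) `^ (r / (r - 1))) `^ r^-1
       * \sum_(j < m) (t j * s j)^-1 * (1 - c / (t j * s j)) `^ (r - 1)^-1 <= 1)
    (mass_eq1 : m = n /\ c = t n * s n \/
       eps / (\sum_(j < m) (1 - c / (t j * s j)) `^ (r / (r - 1))) `^ r^-1
       * \sum_(j < m) (t j * s j)^-1 * (1 - c / (t j * s j)) `^ (r - 1)^-1 = 1) :
  ((error_value t s r eps m c)%:E <=
    optimal_error inner (class_pair t s p q) (@info R n eps r))%E.
Proof.
have r_gt0 : 0 < r by rewrite (lt_trans ltr01).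
have r1_gt0 : 0 < r - 1 by rewrite subr_gt0.
have [r'_gt0 _] := conjugate_exponent r_gt1.
pose u k := t k * s k.
pose be j := 1 - c / u j.
pose ta j := be j `^ (r - 1)^-1.
set S := \sum_(j < m) _ in mass_le1 mass_eq1.
set D := \sum_(j < m) _ in mass_le1 mass_eq1.
set kap := eps / _ in mass_le1 mass_eq1.
have be_ge0 j : (j < m)%N -> 0 <= be j.
  by move=> jm; rewrite subr_ge0 ler_pdivrMr ?mul1r ?c_le // ts_gt0.
have ta_ge0 j : 0 <= ta j by exact: powR_ge0.
have S_ge0 : 0 <= S by apply: sumr_ge0 => j _; exact: powR_ge0.
have kap_ge0 : 0 <= kap by rewrite divr_ge0 // powR_ge0.
have SE : S = \sum_(j < m) ta j `^ r.
  apply: eq_bigr => j _; rewrite /ta -powRrM; congr (_ `^ _).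
  by rewrite mulrC.
have be_ta j : (j < m)%N -> be j * ta j = be j `^ (r / (r - 1)).
  move=> jm; rewrite -(mulr_powRB1 (be_ge0 _ jm) r'_gt0); congr (_ * _ `^ _).
  by field; rewrite gt_eqF.
pose w k := if (k < m)%N then kap * ta k / u k
            else if k == n then 1 - kap * D else 0.
have w_ge0 k : 0 <= w k.
  rewrite /w; case: ifP => _; first by apply: divr_ge0; [exact: mulr_ge0 | exact/ltW/ts_gt0].
  by case: ifP => // _; rewrite subr_ge0.
have w_split (f : nat -> R) : \sum_(k < n.+1) f k * w k =
    kap * (\sum_(j < m) f j * ((u j)^-1 * ta j)) + f n * (1 - kap * D).
  rewrite big_ord_recr /= {2}/w ltnNge m_le_n /= eqxx; congr (_ + _).
  rewrite (big_ord_widen n (fun j => f j * ((u j)^-1 * ta j))) // mulr_sumr.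
  rewrite [RHS]big_mkcond; apply: eq_bigr => k _; rewrite /w; case: ifP => _.
    by ring.
  by rewrite ltn_eqF ?ltn_ord // mulr0.
have -> : error_value t s r eps m c = \sum_(k < n.+1) t k * s k * w k.
  rewrite (w_split u).
  have -> : u n * (1 - kap * D) = c * (1 - kap * D).
    by case: mass_eq1 => [[_ ->] // | ->]; rewrite subrr !mulr0.
  have kapS : kap * S = eps * S `^ ((r - 1) / r).
    rewrite /kap -mulrA; congr (_ * _).
    have -> : (r - 1) / r = 1 - r^-1 by field; rewrite gt_eqF.
    rewrite powRB ?powRr1 1?mulrC //.
    by rewrite (gt_eqF (_ : r^-1 < 1)) // invf_lt1.
  rewrite /error_value -/S -kapS.
  have -> : S = \sum_(j < m) u j * ((u j)^-1 * ta j) - c * D.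
    have -> : D = \sum_(j < m) (u j)^-1 * ta j by [].
    rewrite mulr_sumr -sumrB; apply: eq_bigr => j _.
    rewrite -be_ta // {1}/be; have := ts_gt0 j; rewrite -/(u j).
    move: (u j) (ta j) => a b a_gt0; field.
    by rewrite gt_eqF.
  by ring.
apply: optimal_error_ge => //.
- by move=> k; exact/ltW/ts_gt0.
- by move=> k nk; rewrite /w ltnNge (leq_trans m_le_n (ltnW nk)) /= gtn_eqF.
- under eq_bigr do rewrite -[w _]mul1r.
  rewrite (w_split (fun=> 1)) mul1r.
  under eq_bigr do rewrite mul1r.
  by rewrite -/D addrC subrK.
rewrite powR_root_le //; last by apply: sumr_ge0 => k _; exact: powR_ge0.
have -> : \sum_(k < n) (t k * s k * w k) `^ r = kap `^ r * S.
  rewrite SE (big_ord_widen n (fun j => ta j `^ r)) // mulr_sumr [RHS]big_mkcond.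
  apply: eq_bigr => k _; rewrite /w; case: ifP => _.
    by rewrite -powRM // /u mulrC divfK // gt_eqF // ts_gt0.
  by rewrite ltn_eqF ?ltn_ord // mulr0 powR0 // gt_eqF.
have [->|S_neq0] := eqVneq S 0; first by rewrite mulr0 powR_ge0.
rewrite /kap powRM ?invr_ge0 ?powR_ge0 // -[(S `^ _)^-1]powRN -powRrM.
rewrite mulNr mulVf ?gt_eqF // powRN powRr1 // mulfVK //.
Qed.

(** Splitting the l_1 mass evenly over coordinates of weight u_0 reaches the norm
    bound u_0 of the inner product. *)
Lemma flat_le_optimal (R : realType) (t s : nat -> R) (n m : nat) (p q r eps : R)
    (p_gt1 : 1 < p) (q_def : q = p / (p - 1)) (r_gt1 : 1 < r) (eps_ge0 : 0 <= eps)
    (ts_gt0 : forall k, 0 < t k * s k)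
    (m_gt0 : (0 < m)%N) (m_le_n : (m <= n)%N)
    (flat : forall j, (j < m)%N -> t j * s j = t 0%N * s 0%N)
    (small : t 0%N * s 0%N / m%:R * m%:R `^ r^-1 <= eps) :
  ((t 0%N * s 0%N)%:E <=
    optimal_error inner (class_pair t s p q) (@info R n eps r))%E.
Proof.
have r_gt0 : 0 < r by rewrite (lt_trans ltr01).
have m0 : 0 < m%:R :> R by rewrite ltr0n.
pose w k : R := if (k < m)%N then m%:R^-1 else 0.
have -> : t 0%N * s 0%N = \sum_(k < m) t k * s k * w k.
  under eq_bigr do rewrite /w ltn_ord flat //.
  by rewrite sumr_const card_ord -[RHS]mulr_natr divfK // gt_eqF.
apply: optimal_error_ge => //.
- by move=> k; exact/ltW/ts_gt0.
- by move=> k; rewrite /w; case: ifP => // _; rewrite invr_ge0 ltW.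
- by move=> k mk; rewrite /w ltnNge mk.
- under eq_bigr do rewrite /w ltn_ord.
  by rewrite sumr_const card_ord -[leLHS]mulr_natr mulVf // gt_eqF.
have um_ge0 : 0 <= t 0%N * s 0%N / m%:R by apply: divr_ge0; apply: ltW.
apply: le_trans small; rewrite powR_root_le //; last 2 first.
- by apply: sumr_ge0 => k _; exact: powR_ge0.
- by rewrite mulr_ge0 // powR_ge0.
rewrite powRM ?powR_ge0 // -powRrM mulVf ?gt_eqF // (powRr1 (ltW m0)).
rewrite (_ : \sum_(k < n) _ =
    \sum_(k < n | (k < m)%N) (t 0%N * s 0%N / m%:R) `^ r); last first.
  rewrite [RHS]big_mkcond; apply: eq_bigr => k _; rewrite /w; case: ifP => km.
    by rewrite flat.
  by rewrite mulr0 powR0 // gt_eqF.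
rewrite -(big_ord_widen n (fun=> (t 0%N * s 0%N / m%:R) `^ r)) //.
by rewrite sumr_const card_ord mulr_natr.
Qed.

(** * The thresholds d_m and the equation for lambda *)

(** Clipping at 0 gives a power function continuous on the whole line, so that the
    coefficients 1 - c / u_j may vanish or change sign. *)
Lemma continuous_powR_max (R : realType) (a : R) (a_gt0 : 0 < a) :
  continuous (fun x : R => Num.max x 0 `^ a).
Proof.
move=> x; apply/cvgrPdist_lt => e e_gt0.
have [x_gt0|x_le0] := ltP 0 x.
  have : {for x, continuous (fun y : R => y `^ a)}.
    apply: differentiable_continuous; apply/derivable1_diffP.
    by apply: derivable_powR; rewrite in_itv /= x_gt0.
  move/cvgrPdist_lt => /(_ _ e_gt0) cont.
  near=> y.
  have y_gt0 : 0 < y by near: y; exact: lt_nbhsr.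
  by rewrite (max_l (ltW y_gt0)); near: y.
have root_gt0 : 0 < e `^ a^-1 by apply: powR_gt0.
near=> y; rewrite powR0 ?gt_eqF // sub0r normrN ger0_norm ?powR_ge0 //.
have y_lt : Num.max y 0 < e `^ a^-1.
  by rewrite gt_max root_gt0 andbT; near: y; apply: lt_nbhsl; apply: le_lt_trans root_gt0.
have -> : e = (e `^ a^-1) `^ a by rewrite -powRrM mulVf ?gt_eqF // powRr1 ?ltW.
apply: gt0_ltr_powR => //; rewrite nnegrE.
- by rewrite le_max lexx orbT.
- exact: ltW.
Unshelve. all: by end_near. Qed.

Section Thresholds.
Context {R : realType} (t s : nat -> R) (r : R).
Hypotheses (t_gt0 : forall k, 0 < t k) (s_gt0 : forall k, 0 < s k).
Hypotheses (t_noninc : nonincreasing_seq t) (s_noninc : nonincreasing_seq s).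
Hypothesis (r_gt1 : 1 < r).

Let u k := t k * s k.

Let r_gt0 : 0 < r. Proof. by rewrite (lt_trans ltr01). Qed.
Let r1_gt0 : 0 < r - 1. Proof. by rewrite subr_gt0. Qed.

Lemma weight_gt0 k : 0 < t k * s k.
Proof. exact: mulr_gt0. Qed.

Lemma weight_noninc j k : (j <= k)%N -> t k * s k <= t j * s j.
Proof.
move=> jk; apply: ler_pM; rewrite ?(ltW (t_gt0 _)) ?(ltW (s_gt0 _)) //.
- exact: t_noninc.
- exact: s_noninc.
Qed.

Lemma flat_weight j k : (j <= k)%N -> t k * s k = t 0%N * s 0%N ->
  t j * s j = t 0%N * s 0%N.
Proof.
move=> jk flat; apply/eqP; rewrite eq_le weight_noninc //= -flat.
exact: weight_noninc.
Qed.

Lemma mix_bounds (x : nat -> R) (k : nat) (lam : R) : nonincreasing_seq x ->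
  0 <= lam <= 1 -> x k <= mix x k lam <= x k.-1.
Proof.
move=> x_noninc /andP[lam0 lam1].
have h : x k <= x k.-1 by apply: x_noninc; exact: leq_pred.
have h' : 0 <= x k.-1 - x k by rewrite subr_ge0.
have e1 : mix x k lam = x k + lam * (x k.-1 - x k) by rewrite /mix; ring.
have e2 : mix x k lam = x k.-1 - (1 - lam) * (x k.-1 - x k) by rewrite /mix; ring.
apply/andP; split; first by rewrite e1 lerDl mulr_ge0.
by rewrite e2 gerBl mulr_ge0 // subr_ge0.
Qed.

Lemma mix_weight_bounds (k : nat) (lam : R) : 0 <= lam <= 1 ->
  t k * s k <= mix t k lam * mix s k lam <= t k.-1 * s k.-1.
Proof.
move=> lam01.
have /andP[t1 t2] := mix_bounds k t_noninc lam01.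
have /andP[s1 s2] := mix_bounds k s_noninc lam01.
have t0 := ltW (t_gt0 k); have s0 := ltW (s_gt0 k).
apply/andP; split; apply: ler_pM => //.
- exact: le_trans t0 t1.
- exact: le_trans s0 s1.
Qed.

Lemma mix0 (x : nat -> R) k : mix x k 0 = x k.
Proof. by rewrite /mix subr0 mul1r mul0r addr0. Qed.

Lemma mix1 (x : nat -> R) k : mix x k 1 = x k.-1.
Proof. by rewrite /mix subrr mul1r mul0r add0r. Qed.

Lemma dnum_ge0 m : 0 <= dnum t s r m.
Proof.
rewrite /dnum; case: ifP => _; first exact/ltW/weight_gt0.
rewrite mulr_ge0 ?powR_ge0 // invr_ge0 sumr_ge0 // => j _.
by apply: divr_ge0; [exact: powR_ge0 | exact/ltW/weight_gt0].
Qed.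

(** d_m is the value of eps solving the equation at lambda = 0; for m = 1 and
    u_1 = u_0 the quotient is 0/0, whereas d_1 = u_0. *)
Lemma dnum_eps_of m : (0 < m)%N -> (m = 1%N -> t 1%N * s 1%N < t 0%N * s 0%N) ->
  dnum t s r m = eps_of t s r m (t m * s m).
Proof.
move=> m_gt0 m1; rewrite /dnum; case: eqVneq => [m1E|m_neq1].
  rewrite m1E /eps_of !big_ord1 /= -powRrM.
  have -> : r / (r - 1) * r^-1 = (r - 1)^-1 by field; rewrite !gt_eqF.
  have : (1 - t 1%N * s 1%N / (t 0%N * s 0%N)) `^ (r - 1)^-1 != 0.
    rewrite gt_eqF // powR_gt0 // subr_gt0 ltr_pdivrMr ?weight_gt0 // mul1r.
    exact: m1.
  have := weight_gt0 0; move: (_ `^ _) => T u_gt0 T_neq0.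
  by rewrite invfM invrK mulrCA mulfV ?mulr1.
rewrite /eps_of.
have -> : \sum_(j < m) tau t s r j m `^ r =
    \sum_(j < m) (1 - t m * s m / (t j * s j)) `^ (r / (r - 1)).
  by apply: eq_bigr => j _; rewrite /tau -powRrM [_^-1 * _]mulrC.
by under [X in _ * X^-1 = _]eq_bigr do rewrite mulrC.
Qed.

(** At c = u_m the coefficient of index m vanishes, which glues the equation for
    m + 1 to the one for m. *)
Lemma eps_of_step m : eps_of t s r m.+1 (t m * s m) = eps_of t s r m (t m * s m).
Proof.
have [r'_gt0 _] := conjugate_exponent r_gt1.
have zero : 1 - t m * s m / (t m * s m) = 0.
  by rewrite mulfV ?subrr // gt_eqF // weight_gt0.
rewrite /eps_of !big_ord_recr /= zero !powR0 ?mulr0 ?addr0 //.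
- by rewrite invr_eq0 gt_eqF.
- by rewrite gt_eqF.
Qed.

Lemma dnum_flat0 m : (1 < m)%N -> t m * s m = t 0%N * s 0%N -> dnum t s r m = 0.
Proof.
move=> m_gt1 flat; rewrite dnum_eps_of ?(ltn_trans _ m_gt1) //; last first.
  by move=> m1; rewrite m1 in m_gt1.
rewrite /eps_of [X in X `^ r^-1]big1 ?powR0 ?mul0r //.
  by rewrite invr_eq0 gt_eqF.
move=> j _; rewrite flat (flat_weight (ltnW (ltn_ord j)) flat).
rewrite mulfV ?subrr ?powR0 // gt_eqF ?weight_gt0 //.
by have [] := conjugate_exponent r_gt1.
Qed.

(** Here all the tau_j coincide, and d_m is the l_r norm of the even distribution of
    mass 1 over m coordinates of weight u_0. *)
Lemma dnum_flat m : (1 < m)%N -> t m * s m < t 0%N * s 0%N ->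
  t m.-1 * s m.-1 = t 0%N * s 0%N ->
  dnum t s r m = t 0%N * s 0%N / m%:R * m%:R `^ r^-1.
Proof.
move=> m_gt1 drop flat; rewrite /dnum gtn_eqF //.
pose T := (1 - t m * s m / (t 0%N * s 0%N)) `^ (r - 1)^-1.
have T_gt0 : 0 < T.
  by rewrite powR_gt0 // subr_gt0 ltr_pdivrMr ?weight_gt0 // mul1r.
have wE (j : 'I_m) : t j * s j = t 0%N * s 0%N.
  apply: flat_weight flat; rewrite -ltnS prednK //; exact: ltnW.
have tauE (j : 'I_m) : tau t s r j m = T by rewrite /tau wE.
under eq_bigr do rewrite tauE.
under [X in _ * X^-1]eq_bigr do rewrite tauE wE.
rewrite !sumr_const card_ord -[_ *+ m]mulr_natr -[(_ / _) *+ m]mulr_natr.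
have m_gt0 : 0 < m%:R :> R by rewrite ltr0n ltnW.
rewrite powRM ?powR_ge0 ?ltW // -powRrM mulfV ?gt_eqF // powRr1 ?ltW //.
by field; rewrite !gt_eqF.
Qed.

(** For c between u_k and u_(k-1) < u_0 the coefficient of index 0 is positive, so
    the quotient in the equation for lambda is defined and continuous. *)
Lemma eps_of_surjective (k : nat) (e : R) : (0 < k)%N ->
  t k.-1 * s k.-1 < t 0%N * s 0%N ->
  eps_of t s r k (t k * s k) <= e <= eps_of t s r k (t k.-1 * s k.-1) ->
  exists2 lam : R, 0 <= lam <= 1 &
    eps_of t s r k (mix t k lam * mix s k lam) = e.
Proof.
move=> k_gt0 drop e_bounds.
have [r'_gt0 _] := conjugate_exponent r_gt1.
pose c lam := mix t k lam * mix s k lam.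
pose P a x : R := Num.max x 0 `^ a.
pose F lam : R := P r^-1 (\sum_(j < k) P (r / (r - 1)) (1 - c lam / u j))
    * (\sum_(j < k) (u j)^-1 * P (r - 1)^-1 (1 - c lam / u j))^-1.
have be_ge0 lam : 0 <= lam <= 1 -> forall j, (j < k)%N -> 0 <= 1 - c lam / u j.
  move=> lam01 j jk; rewrite subr_ge0 ler_pdivrMr ?weight_gt0 // mul1r.
  have /andP[_ /le_trans] := mix_weight_bounds k lam01; apply.
  by apply: weight_noninc; rewrite -ltnS prednK.
have FE lam : 0 <= lam <= 1 -> F lam = eps_of t s r k (c lam).
  move=> lam01; rewrite /F /eps_of /P max_l; last first.
    by apply: sumr_ge0 => j _; exact: powR_ge0.
  under eq_bigr do rewrite max_l ?be_ge0 //.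
  by under [X in _ * X^-1]eq_bigr do rewrite max_l ?be_ge0 //.
have c_cont : continuous c.
  move=> x; apply: cvgM; apply: cvgD; apply: cvgM; try exact: cvg_cst; try exact: cvg_id.
  - by apply: cvgB; [exact: cvg_cst | exact: cvg_id].
  - by apply: cvgB; [exact: cvg_cst | exact: cvg_id].
have be_cont a j : 0 < a -> continuous (fun lam => P a (1 - c lam / u j)).
  move=> a_gt0 x; apply: (@continuous_comp _ _ _ (fun lam => 1 - c lam / u j) (P a)).
    apply: cvgB; first exact: cvg_cst.
    by apply: cvgM; [exact: c_cont | exact: cvg_cst].
  exact: continuous_powR_max.
have sum_cont (G : nat -> R -> R) : (forall j, continuous (G j)) ->
    continuous (fun lam => \sum_(j < k) G j lam).
  move=> G_cont x; apply: cvg_big => [|j _]; last exact: G_cont.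
  exact: add_continuous.
have [lam] : exists2 lam, lam \in `[0, 1] & F lam = e.
  apply: IVT => //.
    apply: continuous_in_subspaceT => x; rewrite inE /= in_itv /= => x01.
    apply: cvgM.
      apply: (@continuous_comp _ _ _ (fun lam => \sum_(j < k) P (r / (r - 1)) (1 - c lam / u j)) (P r^-1)).
        by apply: (sum_cont (fun j lam => P (r / (r - 1)) (1 - c lam / u j))) => j; exact: be_cont.
      by apply: continuous_powR_max; rewrite invr_gt0.
    apply: cvgV; last first.
      apply: (sum_cont (fun j lam => (u j)^-1 * P (r - 1)^-1 (1 - c lam / u j))) => j y.
      apply: cvgM; first exact: cvg_cst.
      by apply: be_cont; rewrite invr_gt0.
    rewrite gt_eqF // (bigD1 (Ordinal k_gt0)) //= ltr_wpDr //.
      apply: sumr_ge0 => j _; apply: mulr_ge0; last exact: powR_ge0.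
      by rewrite invr_ge0 ltW // weight_gt0.
    rewrite mulr_gt0 ?invr_gt0 ?weight_gt0 // powR_gt0 // lt_max.
    rewrite subr_gt0 ltr_pdivrMr ?weight_gt0 // mul1r.
    by have /andP[_ /le_lt_trans ->] := mix_weight_bounds k x01.
  have [F0 F1] : F 0 = eps_of t s r k (t k * s k) /\
      F 1 = eps_of t s r k (t k.-1 * s k.-1).
    by rewrite !FE /c ?mix0 ?mix1 ?lexx ?ler01.
  rewrite F0 F1; have /andP[e0 e1] := e_bounds.
  by rewrite ge_min e0 le_max e1 orbT.
by rewrite in_itv /= => lam01 <-; exists lam => //; rewrite FE.
Qed.

End Thresholds.

(** * The three ranges of the noise level *)

Section Regimes.
Context {R : realType} (t s : nat -> R) (n : nat) (p q r eps : R).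
Hypotheses (t_gt0 : forall k, 0 < t k) (s_gt0 : forall k, 0 < s k).
Hypotheses (t_noninc : nonincreasing_seq t) (s_noninc : nonincreasing_seq s).
Hypotheses (p_gt1 : 1 < p) (q_def : q = p / (p - 1)).
Hypotheses (r_gt1 : 1 < r) (eps_ge0 : 0 <= eps).

Let W := class_pair t s p q.
Let J := @info R n eps r.

Let ts_gt0 := weight_gt0 t_gt0 s_gt0.
Let ts_noninc := weight_noninc t_gt0 s_gt0 t_noninc s_noninc.

Lemma trunc_method_error_le_between k c : (k <= n)%N ->
    t k * s k <= c <= t k.-1 * s k.-1 ->
  (recovery_error inner W J (@trunc_method R t s n k c) <=
    (error_value t s r eps k c)%:E)%E.
Proof.
move=> kn /andP[c_ge c_le]; apply: trunc_method_error_le => //.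
- exact: le_trans (ltW (ts_gt0 _)) c_ge.
- move=> j jk; apply: (le_trans c_le); apply: ts_noninc.
  by rewrite -ltnS prednK // (leq_trans _ jk).
- by move=> i ki; apply: le_trans c_ge; exact: ts_noninc.
Qed.

(** A solution of the equation for lambda makes the proportional witness have
    total mass exactly 1, so that it fits into the measured coordinates. *)
Lemma trunc_method_optimal_at_solution k c : (k <= n)%N -> 0 < eps ->
    t k * s k <= c <= t k.-1 * s k.-1 -> eps = eps_of t s r k c ->
  optimal_error inner W J = recovery_error inner W J (@trunc_method R t s n k c) /\
  recovery_error inner W J (@trunc_method R t s n k c) =
    (error_value t s r eps k c)%:E.
Proof.
move=> kn eps_gt0 c_bounds epsE; apply: optimal_method.
  exact: trunc_method_error_le_between.
have /andP[_ c_le] := c_bounds.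
have mass1 : eps / (\sum_(j < k) (1 - c / (t j * s j)) `^ (r / (r - 1))) `^ r^-1
    * \sum_(j < k) (t j * s j)^-1 * (1 - c / (t j * s j)) `^ (r - 1)^-1 = 1.
  move: epsE; rewrite /eps_of; set a := _ `^ r^-1; set b := \sum_(j < k) _ * _.
  move=> epsE.
  have a_neq0 : a != 0.
    by apply: contraTneq eps_gt0 => a0; rewrite epsE a0 mul0r ltxx.
  have b_neq0 : b != 0.
    by apply: contraTneq eps_gt0 => b0; rewrite epsE b0 invr0 mulr0 ltxx.
  by rewrite epsE mulrAC divfK // mulfV.
apply: error_value_le_optimal => //.
- move=> j jk; apply: (le_trans c_le); apply: ts_noninc.
  by rewrite -ltnS prednK // (leq_trans _ jk).
- by rewrite mass1.
- by right.
Qed.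

(** The condition eps <= d_n says that the proportional witness has mass at most 1;
    the rest goes to the coordinate n, of weight c = u_n. *)
Lemma trunc_method_optimal_small_noise : (0 < n)%N -> eps <= dnum t s r n ->
  optimal_error inner W J =
    recovery_error inner W J (@trunc_method R t s n n (t n * s n)) /\
  recovery_error inner W J (@trunc_method R t s n n (t n * s n)) =
    (error_value t s r eps n (t n * s n))%:E.
Proof.
move=> n_gt0 eps_le; apply: optimal_method.
  by apply: trunc_method_error_le_between => //; rewrite lexx ts_noninc // leq_pred.
apply: error_value_le_optimal => //; last by left.
  by move=> j jn; apply: ts_noninc; exact: ltnW.
set S := (\sum_(j < n) (1 - _) `^ (r / (r - 1))).
set D := \sum_(j < n) _ * _.
have D_ge0 : 0 <= D.
  by apply: sumr_ge0 => j _; rewrite mulr_ge0 ?powR_ge0 // invr_ge0 ltW.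
have [D0|D_neq0] := eqVneq D 0; first by rewrite D0 mulr0 ler01.
have D_gt0 : 0 < D by rewrite lt_def D_neq0.
have [S0|S_neq0] := eqVneq (S `^ r^-1) 0.
  by rewrite S0 invr0 mulr0 mul0r ler01.
have S_gt0 : 0 < S `^ r^-1 by rewrite lt_def S_neq0 powR_ge0.
rewrite mulrAC ler_pdivrMr // mul1r -ler_pdivlMr //.
apply: (le_trans eps_le); rewrite dnum_eps_of // => n1.
rewrite lt_def ts_noninc // andbT; apply: contra_neq D_neq0 => u01.
rewrite /D n1 big_ord1 u01 mulfV ?gt_eqF // subrr powR0 ?mulr0 //.
by rewrite invr_eq0 gt_eqF // subr_gt0.
Qed.

(** The zero method is the truncated method with no term and threshold u_0, and
    mass 1 on the first coordinate is invisible to data of accuracy u_0. *)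
Lemma zero_method_optimal : (0 < n)%N -> t 0%N * s 0%N <= eps ->
  optimal_error inner W J = recovery_error inner W J (@zero_method R n) /\
  recovery_error inner W J (@zero_method R n) = (t 0%N * s 0%N)%:E.
Proof.
move=> n_gt0 eps_ge; apply: optimal_method.
  have -> : @zero_method R n = trunc_method t s 0 (t 0%N * s 0%N).
    by apply/funext => ab; rewrite /zero_method /trunc_method big_pred0.
  have := @trunc_method_error_le_between 0 (t 0%N * s 0%N) isT; rewrite lexx => /(_ isT).
  rewrite /error_value big_ord0 powR0 ?mulr0 ?addr0 //.
  by rewrite mulf_neq0 ?invr_eq0 // ?subr_eq0 gt_eqF // (lt_trans ltr01).
apply: (@flat_le_optimal _ t s n 1) => //; first by case.
by rewrite divr1 powR1 mulr1.
Qed.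

Lemma unmeasured_le_optimal :
  ((t n * s n)%:E <= optimal_error inner W J)%E.
Proof.
pose w k : R := (k == n)%:R.
have dirac (f : nat -> R) : \sum_(k < n.+1) f k * w k = f n.
  rewrite big_ord_recr /= /w eqxx mulr1 big1 ?add0r // => i _.
  by rewrite ltn_eqF ?ltn_ord // mulr0.
rewrite -(dirac (fun k => t k * s k)); apply: optimal_error_ge => //.
- by move=> k; exact/ltW.
- by move=> k nk; rewrite /w gtn_eqF.
- by have := dirac (fun=> 1); under eq_bigr do rewrite mul1r; move=> ->.
rewrite big1 ?powR0 // ?invr_eq0 ?gt_eqF ?(lt_trans ltr01) // => k _.
by rewrite /w ltn_eqF ?ltn_ord // mulr0 powR0 // gt_eqF // (lt_trans ltr01).
Qed.

(** The bound u_0 is attained on the initial run of weights equal to u_0: either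
    the run contains the unmeasured coordinate n, or it has m <= n elements and eps
    exceeds d_m, the l_r norm of the even spread of the mass over it. *)
Lemma trunc_method_optimal_flat : (1 < n)%N -> t 1%N * s 1%N = t 0%N * s 0%N ->
    (forall m, (1 < m <= n)%N -> dnum t s r m < eps) ->
  optimal_error inner W J =
    recovery_error inner W J (@trunc_method R t s n 1 (t 1%N * s 1%N)) /\
  recovery_error inner W J (@trunc_method R t s n 1 (t 1%N * s 1%N)) =
    (error_value t s r eps 1 (t 1%N * s 1%N))%:E.
Proof.
move=> n_gt1 u10 d_lt; apply: optimal_method.
  by apply: trunc_method_error_le_between; [exact: ltnW | rewrite lexx /= u10].
have -> : error_value t s r eps 1 (t 1%N * s 1%N) = t 0%N * s 0%N.
  rewrite /error_value big_ord1 u10 mulfV ?gt_eqF // subrr.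
  have r_neq0 : r != 0 by rewrite gt_eqF // (lt_trans ltr01).
  have r1_neq0 : r - 1 != 0 by rewrite gt_eqF ?subr_gt0.
  by rewrite !powR0 ?mulr0 ?addr0 // mulf_neq0 // invr_eq0.
have [drop|] := boolP (t n * s n < t 0%N * s 0%N); last first.
  rewrite -leNgt => u_le; apply: le_trans unmeasured_le_optimal.
  by rewrite lee_fin.
have ex : exists m, t m * s m < t 0%N * s 0%N by exists n.
case: (ex_minnP ex) => m drop_m min_m.
have mn : (m <= n)%N by exact: min_m.
have flat j : (j < m)%N -> t j * s j = t 0%N * s 0%N.
  move=> jm; apply/eqP; rewrite eq_le ts_noninc //= leNgt.
  by apply: contraL jm => /min_m; rewrite -leqNgt.
have m_gt1 : (1 < m)%N.
  by case: m drop_m {min_m mn flat} => [|[|//]]; rewrite ?u10 ltxx.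
apply: (@flat_le_optimal _ t s n m) => //; first exact: ltnW.
rewrite -dnum_flat ?ltW ?d_lt ?m_gt1 //.
by apply: flat; rewrite prednK // ltnW.
Qed.

(** Taking the largest m with eps <= d_m also controls all later d_j, which
    matters because d is not monotone in general. *)
Lemma last_interval (d : nat -> R) : d n < eps <= d 1%N -> (0 < n)%N ->
  exists m, [/\ (1 <= m < n)%N, d m.+1 < eps <= d m &
    forall j, (m < j <= n)%N -> d j < eps].
Proof.
move=> /andP[dn d1] n_gt0.
have n_gt1 : (1 < n)%N.
  by rewrite ltn_neqAle n_gt0 andbT; apply: contraTneq dn => <-; rewrite -leNgt.
have ex : exists m, (1 <= m < n)%N && (eps <= d m) by exists 1%N; rewrite n_gt1.
have bound m : (1 <= m < n)%N && (eps <= d m) -> (m <= n)%N.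
  by move=> /andP[/andP[_ /ltnW]].
case: (ex_maxnP ex bound) => m /andP[/andP[m_gt0 mn] dm] max_m.
have later j : (m < j <= n)%N -> d j < eps.
  move=> /andP[mj]; have mj' := mj; rewrite leq_eqVlt => /orP[/eqP -> //|jn].
  rewrite ltNge; apply: contraTN mj => dj; rewrite -leqNgt max_m // jn dj !andbT.
  exact: leq_trans m_gt0 (ltnW mj').
exists m; split=> //; first by rewrite m_gt0.
by rewrite dm andbT later // ltnSn.
Qed.

(** When eps is the threshold d_m itself the solution is lambda = 0 at index m. Strictly
    between d_(m+1) and d_m it lies at index m + 1, whose parameter interval
    joins these two values. *)
Lemma trunc_method_optimal_middle_noise :
  (0 < n)%N -> dnum t s r n < eps <= dnum t s r 1 ->
  exists (m k : nat) (lam : R),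
    [/\ (1 <= m < n)%N /\ dnum t s r m.+1 < eps <= dnum t s r m,
        k = m \/ (k = m.+1 /\ eps < dnum t s r m),
        0 <= lam < 1,
        (t k * s k < t 0%N * s 0%N ->
           eps = eps_of t s r k (mix t k lam * mix s k lam)) &
        optimal_error inner W J = recovery_error inner W J
          (@trunc_method R t s n k (mix t k lam * mix s k lam)) /\
        recovery_error inner W J
          (@trunc_method R t s n k (mix t k lam * mix s k lam)) =
          (error_value t s r eps k (mix t k lam * mix s k lam))%:E].
Proof.
move=> n_gt0 eps_bounds.
have [m [mn dm later]] := last_interval eps_bounds n_gt0.
have /andP[m_gt0 m_lt_n] := mn; have /andP[dm1 eps_le] := dm.
have eps_gt0 : 0 < eps by apply: le_lt_trans dm1; exact: dnum_ge0.
have [flat|u_neq] := eqVneq (t m * s m) (t 0%N * s 0%N).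
  have m1 : m = 1%N.
    apply/eqP; rewrite eqn_leq m_gt0 andbT leqNgt; apply: contraTN eps_le => m_gt1.
    by rewrite dnum_flat0 // -ltNge.
  exists m, m, 0; rewrite !mix0; split=> //; first by left.
  - by rewrite lexx ltr01.
  - by rewrite flat ltxx.
  rewrite m1 in flat m_lt_n later *; by apply: trunc_method_optimal_flat.
have drop : t m * s m < t 0%N * s 0%N by rewrite lt_neqAle u_neq ts_noninc.
have dmE : dnum t s r m = eps_of t s r m (t m * s m).
  by apply: dnum_eps_of => // m1; rewrite -m1.
have [eps_eq|eps_neq] := eqVneq eps (dnum t s r m).
  have epsE : eps = eps_of t s r m (t m * s m) by rewrite eps_eq.
  exists m, m, 0; rewrite !mix0; split=> //; first by left.
  - by rewrite lexx ltr01.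
  - apply: trunc_method_optimal_at_solution => //; first exact: ltnW.
    by rewrite lexx ts_noninc // leq_pred.
have eps_lt : eps < dnum t s r m by rewrite lt_neqAle eps_neq.
have [lam /andP[lam0 lam1] lamE] : exists2 lam : R, 0 <= lam <= 1 &
    eps_of t s r m.+1 (mix t m.+1 lam * mix s m.+1 lam) = eps.
  apply: eps_of_surjective => //=; rewrite eps_of_step // -dmE eps_le andbT.
  rewrite -dnum_eps_of //; first exact: ltW.
  by case=> m0; rewrite m0 in m_gt0.
have lam_lt1 : lam < 1.
  rewrite lt_neqAle lam1 andbT; apply: contra_neq eps_neq => lamE1.
  by rewrite -lamE lamE1 !mix1 /= eps_of_step // dmE.
exists m, m.+1, lam; split=> //.
- by right.
- by rewrite lam0.
- apply: trunc_method_optimal_at_solution => //.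
  by apply: mix_weight_bounds => //; rewrite lam0.
Qed.

End Regimes.
Unset Implicit Arguments.

Theorem theorem11 (R : realType) (t s : nat -> R) (n : nat) (p q r eps : R)
    (t_pos : forall k : nat, 0 < t k) (s_pos : forall k : nat, 0 < s k)
    (t_noninc : nonincreasing_seq t) (s_noninc : nonincreasing_seq s)
    (n_pos : (0 < n)%N) (p_gt1 : 1 < p) (q_def : q = p / (p - 1))
    (r_gt1 : 1 < r) (eps_ge0 : 0 <= eps) :
  let W := class_pair t s p q in
  let J := @info R n eps r in
  let d := dnum t s r in
  (* t_{m,lambda} s_{m,lambda} *)
  let c m lam := mix t m lam * mix s m lam in
  (* both equalities for Psi^*_{m,lambda} *)
  let solved m lam :=
    optimal_error inner W J
      = recovery_error inner W J (@trunc_method R t s n m (c m lam)) /\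
    recovery_error inner W J (@trunc_method R t s n m (c m lam))
      = (error_value t s r eps m (c m lam))%:E in
  [/\ eps <= d n ->
        optimal_error inner W J
          = recovery_error inner W J (@trunc_method R t s n n (t n * s n)) /\
        recovery_error inner W J (@trunc_method R t s n n (t n * s n))
          = (error_value t s r eps n (t n * s n))%:E,
      d n < eps <= d 1%N ->
        (exists (m k : nat) (lam : R),
           [/\ (1 <= m < n)%N /\ d m.+1 < eps <= d m,
               k = m \/ (k = m.+1 /\ eps < d m),
               0 <= lam < 1,
               (* the quotient is not 0/0 *)
               (t k * s k < t 0%N * s 0%N -> eps = eps_of t s r k (c k lam)) &
               solved k lam]) /\
        (forall (k : nat) (lam : R),
           (1 <= k <= n)%N -> 0 <= lam < 1 ->
           eps = eps_of t s r k (c k lam) -> solved k lam) &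
      d 1%N < eps ->
        optimal_error inner W J = recovery_error inner W J (@zero_method R n) /\
        recovery_error inner W J (@zero_method R n) = (t 0%N * s 0%N)%:E].
Proof.
move=> W J d c solved.
have eps_gt0 : d n < eps -> 0 < eps by apply: le_lt_trans; exact: dnum_ge0.
split.
- by apply: trunc_method_optimal_small_noise.
- move=> eps_bounds; split; first exact: trunc_method_optimal_middle_noise.
  move=> k lam /andP[_ kn] /andP[lam0 lam1] epsE.
  apply: trunc_method_optimal_at_solution => //.
    by apply: eps_gt0; case/andP: eps_bounds.
  by apply: mix_weight_bounds => //; rewrite lam0 ltW.
- by move=> eps_gt; apply: zero_method_optimal => //; exact: ltW.
Qed.
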